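(* Consider the conditionally Gaussian model of the context (with $\psi$ bounded), suppose the contraction assumption of the context holds for some $r_c>0$, and let $r=\sigma/\gamma\in[0,r_c)$. Let $N\ge1$ and let $\{u_k^{(n)}\}_{n=1}^N$ be the particles of the optimal particle filter with data $\{y^\dagger_k\}$. Then there is a constant $c$, independent of $\gamma$, such that $$\limsup_{k\to\infty}\ \mathbb{E}\Bigl(\max_{1\le n\le N}\bigl\|u_k^{(n)}-u_k^\dagger\bigr\|^2\Bigr)\ \le\ c\,\gamma^2,$$ where $\mathbb{E}$ is expectation with respect to the noise generating the data and the randomness within the particle filter.
   Context: $\mathcal{X}$ and $\mathcal{Y}$ are finite-dimensional Euclidean spaces. For symmetric positive definite $A$, $|\cdot|_A=|A^{-1/2}\cdot|$. Model. $\psi:\mathcal{X}\to\mathcal{X}$ is bounded (and measurable), $H:\mathcal{X}\to\mathcal{Y}$ is linear, and $$u_{k+1}=\psi(u_k)+\xi_k,\qquad y_{k+1}=Hu_{k+1}+\eta_{k+1},$$ with $u_0\sim\mu_0$ (a probability measure on $\mathcal{X}$), $\xi_k\sim N(0,\Sigma)$ i.i.d., $\eta_k\sim N(0,\Gamma)$ i.i.d., and $u_0,\{\xi_k\},\{\eta_k\}$ independent. Here $\Sigma=\sigma^2\Sigma_0$, $\Gamma=\gamma^2\Gamma_0$ with $\Sigma_0,\Gamma_0$ strictly positive definite and fixed, $\sigma,\gamma\in(0,\infty)$, $r:=\sigma/\gamma\in(0,\infty)$. Set $$C^{-1}=\Sigma^{-1}+H^*\Gamma^{-1}H,\quad S=H\Sigma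 H^*+\Gamma,\quad K=\Sigma H^*S^{-1}=r^2\Sigma_0H^*(r^2H\Sigma_0H^*+\Gamma_0)^{-1}.$$ Contraction assumption (with $r_c>0$). $\|\cdot\|$ is a norm on $\mathcal{X}$ and, for all $r\in[0,r_c)$, the function $(I-KH)\psi(\cdot)$ is globally Lipschitz on $\mathcal{X}$ with respect to $\|\cdot\|$ with Lipschitz constant $\alpha=\alpha(r)<1$. Fixed data. Fix $u_0^\dagger\in\mathcal{X}$ and positive semi-definite matrices $\Sigma_*,\Gamma_*$ on $\mathcal{X},\mathcal{Y}$, and let $$u^\dagger_{k+1}=\psi(u^\dagger_k)+r\gamma\,\xi^\dagger_k,\qquad y^\dagger_{k+1}=Hu^\dagger_{k+1}+\gamma\,\eta^\dagger_{k+1},$$ with $\xi^\dagger_k\sim N(0,\Sigma_* )$ i.i.d., $\eta^\dagger_k\sim N(0,\Gamma_* )$ i.i.d., the two sequences being independent. One considers the family parameterized by $\gamma$, with $r$ and the noise sequences $\xi^\dagger,\eta^\dagger$ fixed. Optimal particle filter (OPF). Initialize $u_0^{(n)}\sim\mu_0$ i.i.d., $n=1,\dots,N$. Given data $\{y_k\}$ (here $y_k=y_k^\dagger$), $$\widehat u_{k+1}^{(n)}=(I-KH)\psi(u_k^{(n)})+Ky_{k+1}+\zeta_k^{(n)},\quad \zeta_k^{(n)}\sim N(0,C)\ \text{i.i.d.},$$ $$u_{k+1}^{(n)}=\sum_{m=1}^N \mathbb{I}_{I_{k+1}^{(m)}}(r_{k+1}^{(n)})\,\widehat u_{k+1}^{(m)},\quad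 r_{k+1}^{(n)}\sim U(0,1)\ \text{i.i.d.},$$ with weights $$w_{k+1}^{(n),*}=\exp\bigl(-\tfrac12|y_{k+1}-H\psi(u_k^{(n)})|_S^2\bigr),\quad w_{k+1}^{(n)}=\frac{w_{k+1}^{(n),*}}{\sum_{m=1}^Nw_{k+1}^{(m),*}},$$ and intervals $I_{k+1}^{(m)}=[\alpha_{k+1}^{(m-1)},\alpha_{k+1}^{(m)})$, $\alpha_{k+1}^{(0)}=0$, $\alpha_{k+1}^{(m)}=\alpha_{k+1}^{(m-1)}+w_{k+1}^{(m)}$, $m=1,\dots,N$. The initial particles, $\zeta_k^{(n)}$ and $r_k^{(n)}$ are independent of each other and of the data. *)

(* Defs.v *)
From HB Require Import structures.
From mathcomp Require Import all_boot all_order all_algebra finmap.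
From mathcomp Require Import all_classical all_reals all_analysis.

Set Implicit Arguments.
Unset Strict Implicit.
Unset Printing Implicit Defensive.

Import Order.TTheory GRing.Theory Num.Theory.
Import numFieldNormedType.Exports.

Local Open Scope classical_set_scope.
Local Open Scope ring_scope.

(* Euclidean space is R^d, as column vectors; [borelV R d] is the same type
   carrying the Borel sigma-algebra of its usual topology. *)
Definition borelV (R : realType) (d : nat) :=
  g_sigma_algebraType (@open 'cV[R]_d).

Section linear_algebra.
Context {R : realType}.

Definition dotv d (x y : 'cV[R]_d) : R := (x^T *m y) ord0 ord0.

Definition enorm d (x : 'cV[R]_d) : R := Num.sqrt (dotv x x).

Definition posdef d (A : 'M[R]_d) : Prop :=
  A^T = A /\ forall x : 'cV[R]_d, x != 0 -> 0 < dotv x (A *m x).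

Definition possemidef d (A : 'M[R]_d) : Prop :=
  A^T = A /\ forall x : 'cV[R]_d, 0 <= dotv x (A *m x).

(* A positive semidefinite A has exactly one such root; the value 0 is only
   taken for other A. *)
Definition sqrtmx d (A : 'M[R]_d) : 'M[R]_d :=
  xget 0 [set B | possemidef B /\ B *m B = A].

(* |x|_A = |A^{-1/2} x| *)
Definition wnorm d (A : 'M[R]_d) (x : 'cV[R]_d) : R :=
  enorm (invmx (sqrtmx A) *m x).

Definition is_norm d (nrm : 'cV[R]_d -> R) : Prop :=
  [/\ forall x, 0 <= nrm x,
      forall x, nrm x = 0 -> x = 0,
      forall (a : R) x, nrm (a *: x) = `|a| * nrm x &
      forall x y, nrm (x + y) <= nrm x + nrm y].

End linear_algebra.

Section probability_notions.
Context {R : realType}.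

(* Normal law on the line with mean 0 and variance v >= 0, including the
   degenerate case, in which [normal_prob] takes a conventional value. *)
Definition normal0 (v : R) : set R -> \bar R :=
  if v == 0 then \d_(0 : R) else normal_prob 0 (Num.sqrt v).

(* mu = N(0, A), for A symmetric positive semidefinite, possibly singular:
   under mu every linear form <v, .> is normal with mean 0 and variance
   <v, A v>. *)
Definition gaussian0 d (A : 'M[R]_d) (mu : set (borelV R d) -> \bar R) : Prop :=
  forall (v : 'cV[R]_d) (B : set R), measurable B ->
    mu [set x : 'cV[R]_d | B (dotv v x)] = normal0 (dotv v (A *m v)) B.

Definition same_law d (T : measurableType d) (mu nu : set T -> \bar R) : Prop :=
  forall B, measurable B -> mu B = nu B.

Definition mutually_independent d (Omega : measurableType d)
    (P : probability Omega R) (I : choiceType) (F : I -> set_system Omega) :=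
  forall (J : {fset I}) (E : I -> set Omega),
    (forall i, i \in J -> F i (E i)) ->
    P (\big[setI/setT]_(i <- J) E i) = (\prod_(i <- J) P (E i))%E.

Definition sigma_of d d' (Omega : measurableType d) (T : measurableType d')
    (X : Omega -> T) : set_system Omega :=
  preimage_set_system setT X measurable.

End probability_notions.

Section kalman.
Context {R : realType} {dx dy : nat}.
Variables (H : 'M[R]_(dy, dx)) (Sigma : 'M[R]_dx) (Gamma : 'M[R]_dy).

Definition post_cov : 'M[R]_dx :=
  invmx (invmx Sigma + H^T *m invmx Gamma *m H).

Definition innov_cov : 'M[R]_dy := H *m Sigma *m H^T + Gamma.

Definition gain : 'M[R]_(dx, dy) := Sigma *m H^T *m invmx innov_cov.

End kalman.

(* The gain depends on (sigma, gamma) only through r = sigma / gamma: it is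
   [gain H (r ^+ 2 *: Sigma0) Gamma0], which also makes sense for r = 0. *)
Definition contraction_assumption {R : realType} {dx dy : nat}
    (H : 'M[R]_(dy, dx)) (psi : 'cV[R]_dx -> 'cV[R]_dx)
    (Sigma0 : 'M[R]_dx) (Gamma0 : 'M[R]_dy)
    (nrm : 'cV[R]_dx -> R) (rc : R) : Prop :=
  forall r, 0 <= r < rc ->
    let f x := (1%:M - gain H (r ^+ 2 *: Sigma0) Gamma0 *m H) *m psi x in
    exists2 alpha : R, 0 <= alpha < 1 &
      forall x y, nrm (f x - f y) <= alpha * nrm (x - y).

Section truth.
Context {R : realType} {dx dy : nat}.
Variables (H : 'M[R]_(dy, dx)) (psi : 'cV[R]_dx -> 'cV[R]_dx) (r gamma : R).
Variables (u0 : 'cV[R]_dx) (xi : nat -> 'cV[R]_dx) (eta : nat -> 'cV[R]_dy).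

Fixpoint truth (k : nat) : 'cV[R]_dx :=
  if k is k'.+1 then psi (truth k') + (r * gamma) *: xi k' else u0.

(* only used at k >= 1 *)
Definition data (k : nat) : 'cV[R]_dy := H *m truth k + gamma *: eta k.

End truth.

Section optimal_particle_filter.
Context {R : realType} {dx dy N : nat}.
Variables (H : 'M[R]_(dy, dx)) (psi : 'cV[R]_dx -> 'cV[R]_dx).
Variables (Sigma : 'M[R]_dx) (Gamma : 'M[R]_dy).

Local Notation ensemble := ('I_N -> 'cV[R]_dx).

Definition opf_propagate (u : ensemble) (y : 'cV[R]_dy) (z : ensemble) :
    ensemble := fun n =>
  (1%:M - gain H Sigma Gamma *m H) *m psi (u n) + gain H Sigma Gamma *m y + z n.

Definition opf_raw_weight (u : ensemble) (y : 'cV[R]_dy) (n : 'I_N) : R :=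
  expR (- 2^-1 * wnorm (innov_cov H Sigma Gamma) (y - H *m psi (u n)) ^+ 2).

Definition opf_weight (u : ensemble) (y : 'cV[R]_dy) (n : 'I_N) : R :=
  opf_raw_weight u y n / \sum_(m < N) opf_raw_weight u y m.

(* The sum of the first m weights; particles being numbered from 0, the
   interval attached to particle m is
   [opf_endpoint u y m, opf_endpoint u y m.+1). *)
Definition opf_endpoint (u : ensemble) (y : 'cV[R]_dy) (m : nat) : R :=
  \sum_(j < N | (j < m)%N) opf_weight u y j.

Definition opf_step (u : ensemble) (y : 'cV[R]_dy) (z : ensemble)
    (s : 'I_N -> R) : ensemble := fun n =>
  \sum_(m < N)
    \1_(`[opf_endpoint u y m, opf_endpoint u y m.+1[%classic) (s n)
      *: opf_propagate u y z m.

Fixpoint opf (init : ensemble) (y : nat -> 'cV[R]_dy) (zeta : nat -> ensemble)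
    (s : nat -> 'I_N -> R) (k : nat) : ensemble :=
  if k is k'.+1 then
    opf_step (opf init y zeta s k') (y k) (zeta k') (s k)
  else init.

End optimal_particle_filter.

(* Names of the random inputs; [ObsNoise k] and [Resample k n] stand for the
   variables eta_(k+1) and r_(k+1)^(n), so that index 0 is left out. *)
Inductive source (N : nat) : Type :=
| SysNoise of nat
| ObsNoise of nat
| Init of 'I_N
| Proposal of nat & 'I_N
| Resample of nat & 'I_N.

HB.instance Definition _ (N : nat) := gen_eqMixin (source N).
HB.instance Definition _ (N : nat) := gen_choiceMixin (source N).

Section random_inputs.
Context {R : realType} {dx dy N : nat} {d : measure_display}
  {Omega : measurableType d} (P : probability Omega R).
Variables (xi : nat -> {RV P >-> borelV R dx})
  (eta : nat -> {RV P >-> borelV R dy})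
  (init : 'I_N -> {RV P >-> borelV R dx})
  (zeta : nat -> 'I_N -> {RV P >-> borelV R dx})
  (s : nat -> 'I_N -> {RV P >-> R}).

Definition source_sigma (i : source N) : set_system Omega :=
  match i with
  | SysNoise k => sigma_of (xi k)
  | ObsNoise k => sigma_of (eta k.+1)
  | Init n => sigma_of (init n)
  | Proposal k n => sigma_of (zeta k n)
  | Resample k n => sigma_of (s k.+1 n)
  end.

Definition random_inputs (mu0 : probability (borelV R dx) R)
    (Sigmas : 'M[R]_dx) (Gammas : 'M[R]_dy) (C : 'M[R]_dx) : Prop :=
  [/\ forall k, gaussian0 Sigmas (distribution P (xi k)),
      forall k, gaussian0 Gammas (distribution P (eta k.+1)) &
      forall n, same_law (distribution P (init n)) mu0] /\
  [/\ forall k n, gaussian0 C (distribution P (zeta k n)),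
      forall k n, same_law (distribution P (s k.+1 n)) (uniform_prob (@ltr01 R)) &
      mutually_independent P source_sigma].

End random_inputs.

(* Main.v *)
Require Import Defs.
From HB Require Import structures.
From mathcomp Require Import all_boot all_order all_algebra finmap.
From mathcomp Require Import all_classical all_reals all_analysis.
From mathcomp Require Import measurable_realfun uniform_distribution ring lra.

Set Implicit Arguments.
Unset Strict Implicit.
Unset Printing Implicit Defensive.

Import Order.TTheory GRing.Theory Num.Theory.
Import numFieldNormedType.Exports.

Local Open Scope classical_set_scope.
Local Open Scope ring_scope.

(** Write [A := I - KH].  The observation is [y = H u' + gamma e], where
[u' = psi t + r gamma x] is the new position of the truth, so a propagated
particle has error
[[
A (psi u) + K y + z - u' = A (psi u - psi t) + (z - r gamma A x + gamma K e).
]]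
The first term contracts in [nrm] with a factor [alpha < 1]; the others are
noise.  Resampling only selects propagated particles ([opf_stepE]), so it does
not increase the maximum over the ensemble.  By the convexity inequality
[(alpha a + b)^2 <= alpha a^2 + b^2 / (1 - alpha)], the largest squared error
[M_k] satisfies, pathwise ([max_sqr_error_contract]),
[[
M_(k+1) <= alpha M_k + G_k / (1 - alpha),
]]
with [G_k] a quadratic form in the noise ([noise_bound]).

Since the gain depends on [(sigma, gamma)] only through [r], while the
covariance [C] of the proposal is [gamma^2] times a matrix depending on [r]
only ([gainZ], [post_covZ]), the Gaussian second moments give [E G_k <= g gamma^2]
with [g] independent of [gamma].  Iterating the recursion yields
[limsup E M_k <= g gamma^2 / (1 - alpha)^2].  Only the
linearity of the expectation enters, not the joint law of the noises.

The initial law may have no second moment, hence [E M_0] may be infinite.  The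
iteration therefore starts at [k = 1], where [M_1] has finite mean because [psi]
is bounded ([max_sqr_error_bounded]).

No measurability of [M_k] is needed: it is dominated almost surely by the
measurable function [majorant], built from the noise alone, and the integral of
nonnegative functions, being a supremum over simple functions below, is
monotone without measurability of the smaller one ([ae_le_integral_dom]). *)

(** * Norms and positive definite matrices *)

Section euclidean.
Context {R : realType}.

Lemma dotvE d (x : 'cV[R]_d) : dotv x x = \sum_i x i ord0 ^+ 2.
Proof. by rewrite /dotv mxE; apply: eq_bigr => i _; rewrite mxE expr2. Qed.

Lemma enorm_ge0 d (x : 'cV[R]_d) : 0 <= enorm x.
Proof. exact: sqrtr_ge0. Qed.

Lemma enorm_sqr d (x : 'cV[R]_d) : enorm x ^+ 2 = \sum_i x i ord0 ^+ 2.
Proof.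
by rewrite sqr_sqrtr dotvE// sumr_ge0// => i _; rewrite sqr_ge0.
Qed.

Lemma ler_coord_enorm d (x : 'cV[R]_d) i : `|x i ord0| <= enorm x.
Proof.
rewrite -(@ler_pXn2r _ 2)// ?nnegrE ?enorm_ge0// real_normK ?num_real//.
rewrite enorm_sqr (bigD1 i)//= lerDl sumr_ge0// => j _; exact: sqr_ge0.
Qed.

(** Every seminorm on a Euclidean space is dominated by the Euclidean norm. *)
Lemma seminorm_le_enorm d (p : 'cV[R]_d -> R) :
  (forall x, 0 <= p x) -> (forall a x, p (a *: x) = `|a| * p x) ->
  (forall x y, p (x + y) <= p x + p y) ->
  exists2 L : R, 0 <= L & forall x, p x <= L * enorm x.
Proof.
move=> p0 pZ pD; exists (\sum_i p (delta_mx i ord0)).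
  by apply: sumr_ge0 => i _.
move=> x; have p00 : p 0 = 0 by rewrite -(scale0r 0) pZ normr0 mul0r.
rewrite {1}(matrix_sum_delta x) mulr_suml.
elim/big_ind2: _ => [|a b a' b' ab a'b'|i _]; first by rewrite p00.
  by apply: le_trans (pD _ _) _; exact: lerD.
rewrite big_ord1 pZ mulrC; apply: ler_wpM2l => //; exact: ler_coord_enorm.
Qed.

Lemma dotv_mul m n (A : 'M[R]_(m, n)) x y : dotv x (A *m y) = dotv (A^T *m x) y.
Proof. by rewrite /dotv trmx_mul trmxK mulmxA. Qed.

Lemma posdef_unitmx d (A : 'M[R]_d) : posdef A -> A \in unitmx.
Proof.
move=> [sA pA]; rewrite -row_free_unit; apply: inj_row_free => v vA.
apply/eqP; apply: contraT => v0.
have := pA v^T; rewrite -trmx_eq0 trmxK => /(_ v0).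
by rewrite /dotv trmxK mulmxA vA mul0mx mxE ltxx.
Qed.

Lemma posdef_invmx d (A : 'M[R]_d) : posdef A -> posdef (invmx A).
Proof.
move=> pdA; have uA := posdef_unitmx pdA; case: (pdA) => sA pA; split.
  by rewrite trmx_inv sA.
move=> x x0; have /pA : invmx A *m x != 0.
  by apply: contraNneq x0 => Ax0; rewrite -(mulKVmx uA x) Ax0 mulmx0.
by rewrite dotv_mul sA mulKVmx.
Qed.

Lemma possemidefZ d (a : R) (A : 'M[R]_d) :
  0 <= a -> possemidef A -> possemidef (a *: A).
Proof.
move=> a0 [sA pA]; split; first by rewrite linearZ /= sA.
by move=> x; rewrite -scalemxAl /dotv -scalemxAr mxE mulr_ge0//; exact: pA.
Qed.

Lemma posdefZ d (a : R) (A : 'M[R]_d) : 0 < a -> posdef A -> posdef (a *: A).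
Proof.
move=> a0 [sA pA]; split; first by rewrite linearZ /= sA.
by move=> x x0; rewrite -scalemxAl /dotv -scalemxAr mxE mulr_gt0//; exact: pA.
Qed.

Lemma posdef_possemidef d (A : 'M[R]_d) : posdef A -> possemidef A.
Proof.
move=> [sA pA]; split=> // x; have [->|x0] := eqVneq x 0; last exact/ltW/pA.
by rewrite mulmx0 /dotv mulmx0 mxE.
Qed.

Lemma posdefD d (A B : 'M[R]_d) : posdef A -> possemidef B -> posdef (A + B).
Proof.
move=> [sA pA] [sB pB]; split; first by rewrite linearD /= sA sB.
move=> x x0; rewrite mulmxDl /dotv mulmxDr mxE ltr_wpDr//; [exact: pB|exact: pA].
Qed.

Lemma possemidef_congr m n (B : 'M[R]_m) (H : 'M[R]_(m, n)) :
  possemidef B -> possemidef (H^T *m B *m H).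
Proof.
move=> [sB pB]; split; first by rewrite !trmx_mul sB trmxK mulmxA.
by move=> x; rewrite -!mulmxA dotv_mul trmxK.
Qed.

Lemma possemidef_diag d (A : 'M[R]_d) i : possemidef A -> 0 <= A i i.
Proof.
move=> [_ /(_ (delta_mx i ord0))]; rewrite /dotv -colE trmx_delta -rowE.
by rewrite !mxE.
Qed.

End euclidean.

(** * Scaling of the gain and of the proposal covariance *)

Section kalman_matrices.
Context {R : realType} {dx dy : nat} (H : 'M[R]_(dy, dx)).
Implicit Types (Sigma : 'M[R]_dx) (Gamma : 'M[R]_dy).

Lemma posdef_innov_cov Sigma Gamma :
  posdef Sigma -> posdef Gamma -> posdef (innov_cov H Sigma Gamma).
Proof.
move=> pS pG; rewrite /innov_cov addrC; apply: posdefD => //.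
by have := possemidef_congr H^T (posdef_possemidef pS); rewrite trmxK.
Qed.

Lemma posdef_precision Sigma Gamma : posdef Sigma -> posdef Gamma ->
  posdef (invmx Sigma + H^T *m invmx Gamma *m H).
Proof.
move=> pS pG; apply: posdefD; first exact: posdef_invmx.
exact/possemidef_congr/posdef_possemidef/posdef_invmx.
Qed.

Lemma posdef_post_cov Sigma Gamma : posdef Sigma -> posdef Gamma ->
  posdef (post_cov H Sigma Gamma).
Proof. by move=> pS pG; exact/posdef_invmx/posdef_precision. Qed.

Lemma gainZ (a : R) Sigma Gamma : 0 < a -> posdef Sigma -> posdef Gamma ->
  gain H (a *: Sigma) (a *: Gamma) = gain H Sigma Gamma.
Proof.
move=> a0 pS pG; rewrite /gain.
have -> : innov_cov H (a *: Sigma) (a *: Gamma) = a *: innov_cov H Sigma Gamma.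
  by rewrite /innov_cov -scalemxAr -scalemxAl -scalerDr.
rewrite invmxZ; last exact/posdef_unitmx/posdefZ/posdef_innov_cov.
by rewrite -!scalemxAl -scalemxAr scalerA mulfV ?scale1r// gt_eqF.
Qed.

Lemma post_covZ (a : R) Sigma Gamma : 0 < a -> posdef Sigma -> posdef Gamma ->
  post_cov H (a *: Sigma) (a *: Gamma) = a *: post_cov H Sigma Gamma.
Proof.
move=> a0 pS pG; rewrite /post_cov !invmxZ; try exact/posdef_unitmx/posdefZ.
rewrite -scalemxAr -scalemxAl -scalerDr invmxZ ?invrK//.
apply/posdef_unitmx/posdefZ; first by rewrite invr_gt0.
exact: posdef_precision.
Qed.

End kalman_matrices.

(** * Resampling selects propagated particles *)

Section resampling.
Context {R : realType} {dx dy N : nat}.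
Variables (H : 'M[R]_(dy, dx)) (psi : 'cV[R]_dx -> 'cV[R]_dx).
Variables (Sigma : 'M[R]_dx) (Gamma : 'M[R]_dy).
Implicit Types (u z : 'I_N -> 'cV[R]_dx) (y : 'cV[R]_dy).

Local Notation weight := (opf_weight H psi Sigma Gamma).
Local Notation endpoint := (opf_endpoint H psi Sigma Gamma).

Lemma opf_weight_ge0 u y m : 0 <= weight u y m.
Proof.
rewrite /opf_weight divr_ge0 ?expR_ge0// sumr_ge0// => i _; exact: expR_ge0.
Qed.

Lemma opf_endpoint0 u y : endpoint u y 0 = 0.
Proof. by rewrite /opf_endpoint big_pred0. Qed.

Lemma opf_endpointN u y : (0 < N)%N -> endpoint u y N = 1.
Proof.
move=> N0; rewrite /opf_endpoint (eq_bigl xpredT) => [|i]; last exact: ltn_ord.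
rewrite -mulr_suml mulfV// gt_eqF//.
rewrite (bigD1 (Ordinal N0))//= ltr_wpDr ?expR_gt0//.
by apply: sumr_ge0 => i _; exact: expR_ge0.
Qed.

Lemma opf_endpoint_le u y i j : (i <= j)%N -> endpoint u y i <= endpoint u y j.
Proof.
move=> ij; rewrite /opf_endpoint [leLHS]big_mkcond [leRHS]big_mkcond /=.
apply: ler_sum => k _; case: ifPn => [ki|_]; first by rewrite (leq_trans ki ij).
by case: ifP => // _; exact: opf_weight_ge0.
Qed.

(** The intervals of the resampling step partition [0, 1): a draw in [0, 1)
    selects exactly one particle. *)
Lemma opf_stepE u y z (s : 'I_N -> R) n : 0 <= s n < 1 ->
  exists m, opf_step H psi Sigma Gamma u y z s n =
            opf_propagate H psi Sigma Gamma u y z m.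
Proof.
move=> /andP[s0 s1].
have N0 : (0 < N)%N by apply: leq_ltn_trans (ltn_ord n).
(* The selected particle is the predecessor of the first endpoint above the
   draw. *)
have ex : exists m, s n < endpoint u y m by exists N; rewrite opf_endpointN.
have := ex_minnP ex.
case=> -[|m] sm mmin; first by move: sm; rewrite opf_endpoint0 ltNge s0.
have mN : (m < N)%N by apply: mmin; rewrite opf_endpointN.
have ms : endpoint u y m <= s n.
  by rewrite leNgt; apply/negP => /mmin; rewrite ltnn.
exists (Ordinal mN); rewrite /opf_step (bigD1 (Ordinal mN))//= big1 ?addr0.
  by rewrite indicE mem_set ?scale1r//= in_itv/= ms sm.
move=> i; rewrite -val_eqE/= => im; rewrite indicE memNset ?scale0r//=.
rewrite in_itv/= => /andP[is1 is2]; case: (ltngtP i m) im => // im _.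
- by have := opf_endpoint_le u y im; rewrite leNgt (le_lt_trans ms is2).
- by have := opf_endpoint_le u y im; rewrite leNgt (le_lt_trans is1 sm).
Qed.

End resampling.

(** * Domination of integrals *)

Section integration.
Local Open Scope ereal_scope.

(** Monotonicity of the integral of nonnegative functions, neither of them
    assumed measurable. *)
Lemma ge0_le_integral_dom d (T : measurableType d) (R : realType)
    (mu : {measure set T -> \bar R}) (f g : T -> \bar R) :
  (forall x, 0 <= f x) -> (forall x, f x <= g x) ->
  \int[mu]_x f x <= \int[mu]_x g x.
Proof.
move=> f0 fg; have g0 x : 0 <= g x by exact: le_trans (fg x).
rewrite !ge0_integralTE//; apply: le_ereal_sup => _ [h hf <-]; exists h => // x.
exact: le_trans (hf x) (fg x).
Qed.

(** Almost sure version; only the larger function has to be measurable. *)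
Lemma ae_le_integral_dom d (T : measurableType d) (R : realType)
    (mu : {measure set T -> \bar R}) (f g : T -> \bar R) :
  measurable_fun setT g ->
  (forall x, 0 <= f x) -> (forall x, 0 <= g x) ->
  {ae mu, forall x, f x <= g x} ->
  \int[mu]_x f x <= \int[mu]_x g x.
Proof.
move=> mg f0 g0 [Z [mZ Z0 fgZ]].
(* Raising [g] to +oo on the exceptional set [Z] makes the bound hold
   everywhere and does not change the integral of [g]. *)
pose g' x := if x \in Z then +oo else g x.
have mg' : measurable_fun setT g'.
  apply: measurable_fun_ifT => //; apply: (measurable_fun_bool true).
  rewrite setTI (_ : _ @^-1` _ = Z)//.
  by apply/seteqP; split=> x /=; [move/set_mem|move/mem_set].
apply: (@le_trans _ _ (\int[mu]_x g' x)).
  apply: ge0_le_integral_dom => // x; rewrite /g'.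
  case: ifPn => [_|/negP xZ]; first by rewrite leey.
  by apply: contrapT => fg; apply/xZ/mem_set/fgZ.
rewrite (@ge0_ae_eq_integral _ _ _ mu _ g' g)//.
  by move=> x _; rewrite /g'; case: ifP.
exists Z; split=> // x /= ; apply: contra_notP => Zx _.
by rewrite /g' memNset.
Qed.

Import HBNNSimple.

(** Integration against a measure [nu] with density [p] with respect to [mu].
    Only this inequality between the two integrals is needed, and it holds
    without measurability of [f]. *)
Lemma le_integral_density d (T : measurableType d) (R : realType)
    (mu nu : {measure set T -> \bar R}) (p : T -> \bar R) (f : T -> \bar R) :
  measurable_fun setT p -> (forall x, 0 <= p x) -> (forall x, 0 <= f x) ->
  (forall A, measurable A -> nu A = \int[mu]_(x in A) p x) ->
  \int[nu]_x f x <= \int[mu]_x (f x * p x).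
Proof.
move=> mp p0 f0 nup; rewrite [leLHS]ge0_integralTE//.
apply: ge_ereal_sup => _ [h hf <-].
apply: (@le_trans _ _ (\int[mu]_x ((h x)%:E * p x))); last first.
  apply: ge0_le_integral_dom => x; first by rewrite mule_ge0// lee_fin.
  exact: lee_wpmul2r.
rewrite le_eqVlt; apply/orP; left; apply/eqP.
under [RHS]eq_integral.
  move=> x xD; rewrite fimfunE -fsumEFin// muleC ge0_mule_fsumr; last first.
    by move=> r; rewrite EFinM nnfun_muleindic_ge0.
  over.
rewrite [RHS]ge0_integral_fsum//; last 2 first.
  - move=> r; apply: emeasurable_funM => //.
    by apply/measurable_EFinP/measurableT_comp.
  - by move=> r x _; rewrite EFinM mule_ge0// nnfun_muleindic_ge0.
rewrite sintegralE; apply: eq_fsbigr => r; rewrite inE => -[t _ rE].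
have r0 : (0 <= r)%R by rewrite -rE.
rewrite nup; last exact: measurable_sfunP.
rewrite integral_mkcond -ge0_integralZl//.
- apply: eq_integral => x _; rewrite patchE indicE.
  by case: ifPn => _; rewrite ?mulr1 ?mulr0 ?mule0// muleC.
- by apply/measurable_restrict => //; exact: measurable_funTS.
- by move=> x _; rewrite patchE; case: ifP.
Qed.

End integration.

(** * Second moments of Gaussian vectors *)

Section gaussian_moments.
Context {R : realType}.

(** With [a := x^2 / (4 s^2)] the exponential of the density is
    [exp (- a) * exp (- a)]; one factor absorbs [x^2] by [a * exp (- a) <= 1], the
    other one is the exponential of a normal density of variance [2 s^2]. *)
Lemma sqr_normal_pdf_le (s x : R) : 0 < s ->
  x ^+ 2 * normal_pdf 0 s x <=
  4 * Num.sqrt 2 * s ^+ 2 * normal_pdf 0 (Num.sqrt 2 * s) x.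
Proof.
move=> s0; have s20 : 0 < Num.sqrt 2 * s :> R by rewrite mulr_gt0// sqrtr_gt0.
rewrite !normal_pdfE ?gt_eqF//.
have -> : normal_peak s = Num.sqrt 2 * normal_peak (Num.sqrt 2 * s).
  rewrite /normal_peak exprMn sqr_sqrtr// -(mulrA 2) -(mulrnAr 2).
  rewrite [X in _ = _ * X^-1]sqrtrM//.
  by rewrite [in RHS]invfM mulrA mulfV ?mul1r// gt_eqF// sqrtr_gt0.
set P := normal_peak _; have P0 : 0 <= P by exact: normal_peak_ge0.
rewrite /normal_fun subr0 exprMn sqr_sqrtr//.
set a := x ^+ 2 / (4 * s ^+ 2).
have -> : - x ^+ 2 / (s ^+ 2 *+ 2) = - a + - a.
  by rewrite /a; field; rewrite gt_eqF.
have -> : - x ^+ 2 / ((2 * s ^+ 2) *+ 2) = - a.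
  by rewrite /a; field; rewrite gt_eqF.
rewrite expRD.
have aE : a * expR (- a) <= 1.
  rewrite expRN ler_pdivrMr ?expR_gt0// mul1r.
  by apply: le_trans (expR_ge1Dx a); rewrite lerDr.
have -> : x ^+ 2 = 4 * s ^+ 2 * a by rewrite /a; field; rewrite gt_eqF.
have Q0 : 0 <= Num.sqrt 2 * P * (4 * s ^+ 2) * expR (- a).
  by rewrite !mulr_ge0// ?sqrtr_ge0// ?expR_ge0// ?(ltW s0).
move: (ler_wpM2l Q0 aE) => /=; lra.
Qed.

(** The constant is not sharp: the second moment is [s^2].  Only its
    proportionality to [s^2] matters below. *)
Lemma normal_second_moment_le (s : R) : 0 < s ->
  (\int[normal_prob 0 s]_x (x ^+ 2)%:E <= (4 * Num.sqrt 2 * s ^+ 2)%:E)%E.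
Proof.
move=> s0; have C0 : 0 <= 4 * Num.sqrt 2 * s ^+ 2.
  by rewrite !mulr_ge0 ?sqrtr_ge0 ?(ltW s0).
have pdf0 t x : (0 <= (normal_pdf 0 t x)%:E :> \bar R)%E.
  by rewrite lee_fin normal_pdf_ge0.
have sqr0 (x : R) : (0 <= (x ^+ 2)%:E)%E by rewrite lee_fin sqr_ge0.
have mpdf t : measurable_fun setT (fun x => (normal_pdf 0 t x)%:E : \bar R).
  by apply/measurable_EFinP; exact: measurable_normal_pdf.
have /le_trans : (\int[normal_prob 0 s]_x (x ^+ 2)%:E <=
    \int[lebesgue_measure]_x ((x ^+ 2)%:E * (normal_pdf 0 s x)%:E))%E.
  exact (@le_integral_density _ _ _ lebesgue_measure (normal_prob 0 s) _ _
    (mpdf s) (pdf0 s) sqr0 (fun _ _ => erefl)).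
apply.
pose g x := ((4 * Num.sqrt 2 * s ^+ 2)%:E *
             (normal_pdf 0 (Num.sqrt 2 * s) x)%:E)%E.
apply: (@le_trans _ _ (\int[lebesgue_measure]_x g x)%E).
  apply: ge0_le_integral_dom => x; first by rewrite mule_ge0.
  by rewrite /g -!EFinM lee_fin; exact: sqr_normal_pdf_le.
rewrite /g ge0_integralZl//; first by rewrite integral_normal_pdf mule1.
exact: mpdf.
Qed.

Lemma measurable_coord d (i : 'I_d) :
  measurable_fun [set: borelV R d] (fun x : borelV R d => (x : 'cV[R]_d) i ord0).
Proof.
apply: (measurability _ (RGenOpens.measurableE R)) => //.
move=> _ [_ [a [b ->] <-]]; rewrite setTI; apply: sub_sigma_algebra.
by have /continuousP := @coord_continuous R d 1 i ord0; apply; exact: interval_open.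
Qed.

Context {dsp : measure_display} {Omega : measurableType dsp}.
Variable P : probability Omega R.

Lemma measurable_enorm_sqr d (X : {RV P >-> borelV R d}) :
  measurable_fun setT (fun w => enorm (X w : 'cV[R]_d) ^+ 2).
Proof.
rewrite (_ : (fun _ => _) =
  (fun w => \sum_i (X w : 'cV[R]_d) i ord0 ^+ 2)); last first.
  by apply/funext => w; rewrite enorm_sqr.
apply: measurable_sum => i; apply: measurable_funX.
exact: measurableT_comp (measurable_coord i) _.
Qed.

Lemma gaussian0_coord_moment d (A : 'M[R]_d) (X : {RV P >-> borelV R d}) i :
  possemidef A -> gaussian0 A (distribution P X) ->
  (\int[P]_w ((X w : 'cV[R]_d) i ord0 ^+ 2)%:E <=
   (4 * Num.sqrt 2 * A i i)%:E)%E.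
Proof.
move=> pA gX; have Aii : 0 <= A i i by exact: possemidef_diag.
pose c w := (X w : 'cV[R]_d) i ord0.
have mc : measurable_fun setT c by exact: measurableT_comp (measurable_coord i) _.
(* [normal_prob] lives on [measurableTypeR R], which has the same measurable
   sets as [R] but another display. *)
have mc' : measurable_fun setT (c : Omega -> measurableTypeR R) by exact: mc.
pose Y : {mfun Omega >-> measurableTypeR R} :=
  HB.pack c (isMeasurableFun.Build _ _ _ _ _ mc').
have msqr : measurable_fun setT
    (fun y : measurableTypeR R => ((y : R) ^+ 2)%:E : \bar R).
  by apply/measurable_EFinP; exact: measurable_funX.
have law B : measurable B -> distribution P Y B = normal0 (A i i) B.
  move=> mB; have := gX (delta_mx i ord0) B mB.
  have dE (x : 'cV[R]_d) : dotv (delta_mx i ord0) x = x i ord0.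
    by rewrite /dotv trmx_delta -rowE mxE.
  rewrite dE -colE mxE => <-; rewrite /distribution /pushforward; congr (P _).
  by apply/seteqP; split => w /=; rewrite dE.
have -> : (\int[P]_w ((X w : 'cV[R]_d) i ord0 ^+ 2)%:E =
    \int[distribution P Y]_y ((y : R) ^+ 2)%:E)%E.
  by rewrite ge0_integral_distribution// => y; rewrite lee_fin sqr_ge0.
move: law; rewrite /normal0; case: ifPn => [/eqP-> law|A0 law].
  rewrite (eq_measure_integral (dirac (0 : measurableTypeR R))); last first.
    by move=> B mB _; exact: law.
  by rewrite integral_dirac//= expr0n/= !mulr0 mule0.
rewrite (eq_measure_integral (normal_prob 0 (Num.sqrt (A i i)))); last first.
  by move=> B mB _; exact: law.
apply: le_trans (normal_second_moment_le _) _; last by rewrite sqr_sqrtr.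
by rewrite sqrtr_gt0 lt_neqAle eq_sym A0.
Qed.

Lemma gaussian0_enorm_sqr d (A : 'M[R]_d) (X : {RV P >-> borelV R d}) :
  possemidef A -> gaussian0 A (distribution P X) ->
  (\int[P]_w (enorm (X w : 'cV[R]_d) ^+ 2)%:E <=
   (4 * Num.sqrt 2 * \tr A)%:E)%E.
Proof.
move=> pA gX; under eq_integral do rewrite enorm_sqr -sumEFin.
rewrite ge0_integral_sum//; first last.
- by move=> i w _; rewrite lee_fin sqr_ge0.
- move=> i; apply/measurable_EFinP/measurable_funX.
  exact: measurableT_comp (measurable_coord i) _.
rewrite /mxtrace mulr_sumr -sumEFin; apply: lee_sum => i _.
exact: gaussian0_coord_moment.
Qed.

End gaussian_moments.

(** * Pathwise recursion for the error *)

Section error_recursion.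
Context {R : realType}.

Lemma sqr_add3_le (a b c : R) :
  (a + b + c) ^+ 2 <= 3 * (a ^+ 2 + b ^+ 2 + c ^+ 2).
Proof.
rewrite -subr_ge0 (_ : _ - _ = (a - b) ^+ 2 + (b - c) ^+ 2 + (a - c) ^+ 2).
  by rewrite !addr_ge0// sqr_ge0.
by ring.
Qed.

Lemma sqr_convex_le (alpha a b : R) : 0 <= alpha < 1 ->
  (alpha * a + b) ^+ 2 <= alpha * a ^+ 2 + (1 - alpha)^-1 * b ^+ 2.
Proof.
move=> /andP[al0 al1]; have al1' : 0 < 1 - alpha by rewrite subr_gt0.
rewrite -subr_ge0 (_ : _ - _ =
    alpha * (1 - alpha)^-1 * ((1 - alpha) * a - b) ^+ 2).
  by rewrite mulr_ge0 ?sqr_ge0// mulr_ge0// invr_ge0 ltW.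
by field; rewrite gt_eqF.
Qed.

Context {dx dy N : nat}.
Variables (H : 'M[R]_(dy, dx)) (psi : 'cV[R]_dx -> 'cV[R]_dx).
Variables (Sigma : 'M[R]_dx) (Gamma : 'M[R]_dy).
Variables (nrm : 'cV[R]_dx -> R) (nrm_norm : is_norm nrm).

Local Notation K := (gain H Sigma Gamma).
Local Notation A := (1%:M - K *m H).
Implicit Types (u z : 'I_N -> 'cV[R]_dx) (t x : 'cV[R]_dx) (e : 'cV[R]_dy).

(** Error of a propagated particle when the truth moves from [t] to [psi t + q]
    and is observed with noise [v]. *)
Lemma opf_propagate_error u z m t (q : 'cV[R]_dx) (v : 'cV[R]_dy) :
  opf_propagate H psi Sigma Gamma u (H *m (psi t + q) + v) z m - (psi t + q) =
  A *m (psi (u m) - psi t) + (- (A *m q) + K *m v + z m).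
Proof.
rewrite /opf_propagate !mulmxBl !mulmxBr !mulmxDr !mul1mx !mulmxA.
set a := psi _; set b := psi t.
set ka := _ *m a; set kb := _ *m b; set kq := _ *m q; set kv := _ *m v.
apply/matrixP => i j; rewrite !mxE; ring.
Qed.

Variables (LA LK LI : R) (LA_ge0 : 0 <= LA) (LK_ge0 : 0 <= LK) (LI_ge0 : 0 <= LI).
Hypothesis leLA : forall x, nrm (A *m x) <= LA * enorm x.
Hypothesis leLK : forall y, nrm (K *m y) <= LK * enorm y.
Hypothesis leLI : forall x, nrm x <= LI * enorm x.
Variables (rho gamma : R) (rho_ge0 : 0 <= rho) (gamma_ge0 : 0 <= gamma).

(** Bound on the squared norm of the noise part of the error of every particle:
    [x], [e] and [z] are the system, observation and proposal noises, [rho] and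
    [gamma] the amplitudes of the first two, and [LA], [LK], [LI] bound the norm of
    [A], [K] and the identity, from the Euclidean norm to [nrm]. *)
Definition noise_bound x e z : R :=
  3 * ((rho * LA) ^+ 2 * enorm x ^+ 2 + (gamma * LK) ^+ 2 * enorm e ^+ 2
       + LI ^+ 2 * \sum_m enorm (z m) ^+ 2).

Lemma noise_bound_ge0 x e z : 0 <= noise_bound x e z.
Proof.
rewrite mulr_ge0// !addr_ge0// mulr_ge0 ?sqr_ge0// sumr_ge0// => m _.
exact: sqr_ge0.
Qed.

Lemma opf_step_error u z (s : 'I_N -> R) n t x e : 0 <= s n < 1 ->
  let t' := psi t + rho *: x in
  exists m, exists2 g : R,
    0 <= g /\ g ^+ 2 <= noise_bound x e z &
    nrm (opf_step H psi Sigma Gamma u (H *m t' + gamma *: e) z s n - t')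
    <= nrm (A *m (psi (u m) - psi t)) + g.
Proof.
move=> s01 t'; have [nrm0 _ nrmZ nrmD] := nrm_norm.
have [m ->] := opf_stepE H psi Sigma Gamma u (H *m t' + gamma *: e) z s01.
exists m; exists (rho * LA * enorm x + gamma * LK * enorm e + LI * enorm (z m)).
  split.
    by rewrite !addr_ge0// !mulr_ge0// enorm_ge0.
  apply: le_trans (sqr_add3_le _ _ _) _; rewrite ler_wpM2l//.
  rewrite ![(_ * enorm _) ^+ 2]exprMn lerD2l ler_wpM2l ?sqr_ge0//.
  by rewrite (bigD1 m)//= lerDl sumr_ge0// => i _; exact: sqr_ge0.
rewrite opf_propagate_error; apply: le_trans (nrmD _ _) _; rewrite lerD2l.
apply: le_trans (nrmD _ _) _; apply: lerD => //.
apply: le_trans (nrmD _ _) _; apply: lerD.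
  rewrite -scaleN1r -scalemxAr !nrmZ normrN1 mul1r ger0_norm//.
  by rewrite -mulrA ler_wpM2l.
by rewrite -scalemxAr nrmZ ger0_norm// -mulrA ler_wpM2l.
Qed.

(** Largest squared error of the ensemble [u] with respect to the truth [t]. *)
Definition max_sqr_error u t : R :=
  \big[Num.max/0]_(n < N) (nrm (u n - t) ^+ 2).

Lemma max_sqr_error_ge0 u t : 0 <= max_sqr_error u t.
Proof. exact: bigmax_ge_id. Qed.

(** A bound after one step that does not involve the ensemble before it. *)
Lemma max_sqr_error_bounded u z (s : 'I_N -> R) t t' x e (D : R) :
  (forall n, 0 <= s n < 1) ->
  (forall x y, nrm (A *m (psi x - psi y)) <= D) ->
  t' = psi t + rho *: x ->
  max_sqr_error (opf_step H psi Sigma Gamma u (H *m t' + gamma *: e) z s) t'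
  <= 2 * D ^+ 2 + 2 * noise_bound x e z.
Proof.
move=> s01 hD ->; have nrm0 : forall x, 0 <= nrm x by case: nrm_norm.
apply: bigmax_le => [|n _].
  by rewrite addr_ge0// mulr_ge0// ?sqr_ge0// noise_bound_ge0.
have [m [g [g0 gG] le_g]] := opf_step_error u z t x e (s01 n).
have {le_g} := le_trans le_g (lerD (hD (u m) t) (lexx g)) => le_g.
have D0 : 0 <= D by exact: le_trans (nrm0 _) (hD 0 0).
apply: (@le_trans _ _ ((D + g) ^+ 2)).
  by rewrite ler_pXn2r// nnegrE// addr_ge0.
have := sqr_ge0 (D - g); nra.
Qed.

Lemma max_sqr_error_contract (alpha : R) u z (s : 'I_N -> R) t t' x e :
  (forall n, 0 <= s n < 1) -> 0 <= alpha < 1 ->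
  (forall x y, nrm (A *m psi x - A *m psi y) <= alpha * nrm (x - y)) ->
  t' = psi t + rho *: x ->
  max_sqr_error (opf_step H psi Sigma Gamma u (H *m t' + gamma *: e) z s) t'
  <= alpha * max_sqr_error u t + (1 - alpha)^-1 * noise_bound x e z.
Proof.
move=> s01 al hal t'E; have nrm0 : forall x, 0 <= nrm x by case: nrm_norm.
case/andP: (al) => al0 al1.
apply: bigmax_le => [|n _].
  rewrite addr_ge0// mulr_ge0 ?max_sqr_error_ge0 ?noise_bound_ge0//.
  by rewrite invr_ge0 subr_ge0 ltW.
have [m [g [g0 gG] le_g]] := opf_step_error u z t x e (s01 n).
have {}le_g : nrm (opf_step H psi Sigma Gamma u (H *m t' + gamma *: e) z s n - t')
    <= alpha * nrm (u m - t) + g.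
  by rewrite t'E; apply: le_trans le_g _; rewrite lerD2r mulmxBr.
apply: (@le_trans _ _ ((alpha * nrm (u m - t) + g) ^+ 2)).
  by rewrite ler_pXn2r// nnegrE// addr_ge0// mulr_ge0.
apply: le_trans (sqr_convex_le _ _ al) _; apply: lerD.
  by rewrite ler_wpM2l//; exact: le_bigmax.
by rewrite ler_wpM2l// invr_ge0 subr_ge0 ltW.
Qed.

End error_recursion.

(** * Expectation of the recursion *)

Section expectation_recursion.
Context {R : realType} {d : measure_display} {T : measurableType d}.
Variable P : probability T R.

Lemma integral_lin_le (a b x y : R) (f g : T -> R) :
  0 <= a -> 0 <= b -> measurable_fun setT f -> measurable_fun setT g ->
  (forall w, 0 <= f w) -> (forall w, 0 <= g w) ->
  (\int[P]_w (f w)%:E <= x%:E)%E -> (\int[P]_w (g w)%:E <= y%:E)%E ->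
  (\int[P]_w (a * f w + b * g w)%:E <= (a * x + b * y)%:E)%E.
Proof.
move=> a0 b0 mf mg f0 g0 fx gy.
under eq_integral do rewrite EFinD !EFinM.
have mf' : measurable_fun setT (fun w => (f w)%:E) by exact/measurable_EFinP.
have mg' : measurable_fun setT (fun w => (g w)%:E) by exact/measurable_EFinP.
rewrite ge0_integralD//; first last.
- exact: measurable_funeM.
- by move=> w _; rewrite -EFinM lee_fin mulr_ge0.
- exact: measurable_funeM.
- by move=> w _; rewrite -EFinM lee_fin mulr_ge0.
rewrite !ge0_integralZl//; try by move=> w _; rewrite lee_fin.
by rewrite EFinD !EFinM; apply: leeD; apply: lee_wpmul2l; rewrite ?lee_fin.
Qed.

(** Solution of the recursion for the squared error in which inequalities are
    replaced by equalities.  [majorant alpha D G k] dominates the error at time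
    [k + 1]. *)
Fixpoint majorant (alpha D : R) (G : nat -> T -> R) (k : nat) (w : T) : R :=
  if k is k'.+1 then
    alpha * majorant alpha D G k' w + (1 - alpha)^-1 * G k w
  else 2 * D ^+ 2 + 2 * G 0%N w.

Variables (alpha D : R) (G : nat -> T -> R) (g : R).
Hypotheses (alpha_itv : 0 <= alpha < 1) (G_ge0 : forall k w, 0 <= G k w).
Hypothesis mG : forall k, measurable_fun setT (G k).

Let alpha_ge0 : 0 <= alpha. Proof. by case/andP: alpha_itv. Qed.
Let beta_gt0 : 0 < 1 - alpha.
Proof. by case/andP: alpha_itv => _; rewrite subr_gt0. Qed.
Let beta_ge0 : 0 <= (1 - alpha)^-1. Proof. by rewrite invr_ge0 ltW. Qed.

Lemma majorant_ge0 k w : 0 <= majorant alpha D G k w.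
Proof.
elim: k => [|k ih] /=; first by rewrite addr_ge0// mulr_ge0// sqr_ge0.
by rewrite addr_ge0// mulr_ge0.
Qed.

Lemma measurable_majorant k : measurable_fun setT (majorant alpha D G k).
Proof.
elim: k => [|k ih] /=.
  by apply: measurable_funD => //; exact: measurable_funM.
by apply: measurable_funD; exact: measurable_funM.
Qed.

Hypothesis Gg : forall k, (\int[P]_w (G k w)%:E <= g%:E)%E.

Lemma integral_majorant_le k :
  (\int[P]_w (majorant alpha D G k w)%:E <=
   (alpha ^+ k * (2 * D ^+ 2 + 2 * g) + g / (1 - alpha) ^+ 2)%:E)%E.
Proof.
have g0 : 0 <= g.
  rewrite -lee_fin; apply: le_trans (Gg 0); apply: integral_ge0 => w _.
  by rewrite lee_fin.
elim: k => [|k ih].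
  apply: (@le_trans _ _ (2 * D ^+ 2 + 2 * g)%:E).
    apply: integral_lin_le => //; rewrite ?sqr_ge0//.
    by rewrite integral_cst// -[leRHS]mule1 lee_wpmul2l ?lee_fin ?sqr_ge0//
      probability_le1.
  by rewrite lee_fin expr0 mul1r lerDl divr_ge0 ?sqr_ge0.
have := integral_lin_le alpha_ge0 beta_ge0 (measurable_majorant k) (mG k.+1)
  (majorant_ge0 k) (G_ge0 k.+1) ih (Gg k.+1).
move=> /le_trans; apply; rewrite lee_fin (exprS alpha k) le_eqVlt; apply/orP; left.
by apply/eqP; field; rewrite gt_eqF.
Qed.

End expectation_recursion.

Lemma limn_esup_geometric_le (R : realType) (f : nat -> \bar R) (alpha b q : R) :
  0 <= alpha < 1 -> (forall k, (f k.+1 <= (alpha ^+ k * b + q)%:E)%E) ->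
  (limn_esup f <= q%:E)%E.
Proof.
move=> /andP[al0 al1] fle; apply/lee_addgt0Pr => e e0.
have : (fun k => alpha ^+ k * b) @ \oo --> (0 : R).
  rewrite -[X in _ --> X](mul0r b); apply: cvgMl.
  by apply: cvg_expr; rewrite ger0_norm.
move=> /cvgrPdist_le /(_ e e0) [n _ hn].
apply: (@le_trans _ _ (ereal_sup (f @` [set k | (n < k)%N]))).
  by apply: ereal_inf_lbound => /=; exists [set k | (n < k)%N] => //; exists n.+1.
apply: ge_ereal_sup => _ [[//|k] /= nk <-]; apply: le_trans (fle k) _.
rewrite -EFinD lee_fin addrC lerD2l; apply: le_trans (ler_norm _) _.
by have := hn k nk; rewrite sub0r normrN.
Qed.

(** The value 1, for which no particle is selected, has probability 0. *)
Lemma uniform_ae01 (R : realType) d (T : measurableType d) (P : probability T R)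
    (s : {RV P >-> R}) :
  same_law (distribution P s) (uniform_prob (@ltr01 R)) ->
  {ae P, forall w, 0 <= s w < 1}.
Proof.
move=> law; exists (s @^-1` ~` `[0, 1[%classic); split.
- by rewrite -[X in measurable X]setTI; apply: measurable_funP => //; exact: measurableC.
- have := law (~` `[0, 1[%classic) (measurableC _).
  rewrite /distribution /pushforward => -> //.
  rewrite /uniform_prob integral_uniform_pdf; apply: (@integral_Sset1 _ _ _ 1).
  move=> x /= []; rewrite !in_itv/= => nx /andP[x0 x1].
  by apply/eqP; rewrite eq_le x1 leNgt; apply/negP => xl; apply: nx; rewrite x0 xl.
- by move=> w /= sw; rewrite in_itv.
Qed.

Lemma integral_noise_bound_le (R : realType) (dx dy N : nat)
    (d : measure_display) (T : measurableType d) (P : probability T R)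
    (LA LK LI rho gamma a b c : R)
    (X : {RV P >-> borelV R dx}) (Y : {RV P >-> borelV R dy})
    (Z : 'I_N -> {RV P >-> borelV R dx}) :
  (\int[P]_w (enorm (X w : 'cV[R]_dx) ^+ 2)%:E <= a%:E)%E ->
  (\int[P]_w (enorm (Y w : 'cV[R]_dy) ^+ 2)%:E <= b%:E)%E ->
  (forall m, \int[P]_w (enorm (Z m w : 'cV[R]_dx) ^+ 2)%:E <= c%:E)%E ->
  measurable_fun setT
    (fun w => noise_bound LA LK LI rho gamma (X w) (Y w) (Z^~ w)) /\
  (\int[P]_w (noise_bound LA LK LI rho gamma (X w) (Y w) (Z^~ w))%:E <=
   (3 * ((rho * LA) ^+ 2 * a + (gamma * LK) ^+ 2 * b
         + LI ^+ 2 * (N%:R * c)))%:E)%E.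
Proof.
move=> ha hb hc.
have mX := measurable_enorm_sqr X; have mY := measurable_enorm_sqr Y.
have mZ m := measurable_enorm_sqr (Z m).
have mS : measurable_fun setT (fun w => \sum_m enorm (Z m w : 'cV[R]_dx) ^+ 2).
  exact: measurable_sum.
have S0 w : 0 <= \sum_m enorm (Z m w : 'cV[R]_dx) ^+ 2.
  by apply: sumr_ge0 => m _; exact: sqr_ge0.
have hS : (\int[P]_w (\sum_m enorm (Z m w : 'cV[R]_dx) ^+ 2)%:E <= (N%:R * c)%:E)%E.
  under eq_integral do rewrite -sumEFin.
  rewrite ge0_integral_sum//; first last.
  - by move=> m w _; rewrite lee_fin sqr_ge0.
  - by move=> m; exact/measurable_EFinP.
  rewrite mulr_natl -[in X in (_ <= X)%E](card_ord N) -sumr_const -sumEFin.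
  exact: lee_sum.
pose F w := (rho * LA) ^+ 2 * enorm (X w : 'cV[R]_dx) ^+ 2 +
            (gamma * LK) ^+ 2 * enorm (Y w : 'cV[R]_dy) ^+ 2.
have mF : measurable_fun setT F.
  by apply: measurable_funD; exact: measurable_funM.
have F0 w : 0 <= F w by rewrite addr_ge0// mulr_ge0// sqr_ge0.
have hF : (\int[P]_w (F w)%:E <=
    ((rho * LA) ^+ 2 * a + (gamma * LK) ^+ 2 * b)%:E)%E.
  apply: integral_lin_le => //; try exact: sqr_ge0.
  - by move=> w; exact: sqr_ge0.
  - by move=> w; exact: sqr_ge0.
have nE : (fun w => noise_bound LA LK LI rho gamma (X w) (Y w) (Z^~ w)) =
    (fun w => 3 * F w + 3 * LI ^+ 2 * \sum_m enorm (Z m w : 'cV[R]_dx) ^+ 2).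
  by apply/funext => w; rewrite /noise_bound mulrDr mulrA.
split.
  by rewrite nE; apply: measurable_funD; exact: measurable_funM.
rewrite (eq_integral (fun w => (3 * F w + 3 * LI ^+ 2 *
  \sum_m enorm (Z m w : 'cV[R]_dx) ^+ 2)%:E)); last first.
  by move=> w _; congr (_%:E); exact: (congr1 (@^~ w) nE).
rewrite mulrDr (mulrA 3).
by apply: integral_lin_le => //; rewrite mulr_ge0// sqr_ge0.
Qed.

(** * Accuracy of the optimal particle filter *)

Theorem theorem5p1 (R : realType) (dx dy : nat)
  (H : 'M[R]_(dy, dx)) (psi : 'cV[R]_dx -> 'cV[R]_dx)
  (psi_bounded : exists M : R, forall x, enorm (psi x) <= M)
  (psi_measurable :
     measurable_fun [set: borelV R dx] (psi : borelV R dx -> borelV R dx))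
  (mu0 : probability (borelV R dx) R)
  (Sigma0 : 'M[R]_dx) (Gamma0 : 'M[R]_dy)
  (Sigma0_posdef : posdef Sigma0) (Gamma0_posdef : posdef Gamma0)
  (nrm : 'cV[R]_dx -> R) (nrm_norm : is_norm nrm)
  (rc : R) (rc_gt0 : 0 < rc)
  (contraction : contraction_assumption H psi Sigma0 Gamma0 nrm rc)
  (u0 : 'cV[R]_dx) (Sigmas : 'M[R]_dx) (Gammas : 'M[R]_dy)
  (Sigmas_possemidef : possemidef Sigmas)
  (Gammas_possemidef : possemidef Gammas)
  (r : R) (r_range : 0 <= r < rc)
  (N : nat) (N_ge1 : (1 <= N)%N) :
  exists c : R, forall sigma gamma : R, 0 < sigma -> 0 < gamma ->
    r = sigma / gamma ->
    let Sigma := sigma ^+ 2 *: Sigma0 in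
    let Gamma := gamma ^+ 2 *: Gamma0 in
    forall (d : measure_display) (Omega : measurableType d)
      (P : probability Omega R)
      (xi : nat -> {RV P >-> borelV R dx})
      (eta : nat -> {RV P >-> borelV R dy})
      (init : 'I_N -> {RV P >-> borelV R dx})
      (zeta : nat -> 'I_N -> {RV P >-> borelV R dx})
      (s : nat -> 'I_N -> {RV P >-> R}),
    random_inputs xi eta init zeta s mu0 Sigmas Gammas
      (post_cov H Sigma Gamma) ->
    let udag w := truth psi r gamma u0 (fun k => xi k w) in
    let ydag w := data H psi r gamma u0 (fun k => xi k w) (fun k => eta k w) in
    let u w := opf H psi Sigma Gamma (fun n => init n w) (ydag w)
      (fun k n => zeta k n w) (fun k n => s k n w) in
    (limn_esup (fun k =>
       'E_P[(fun w => \big[Num.max/0]_(n < N) (nrm (u w k n - udag w k) ^+ 2))%R])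
     <= (c * gamma ^+ 2)%:E)%E.
Proof.
have [nrm0 _ nrmZ nrmD] := nrm_norm; have [r0 _] := andP r_range.
have [alpha alpha_itv contr] := contraction r r_range.
set K := gain H (r ^+ 2 *: Sigma0) Gamma0 in contr.
have [LI LI0 leLI] := seminorm_le_enorm nrm0 nrmZ nrmD.
have [LA LA0 leLA] : exists2 L : R, 0 <= L &
    forall x, nrm ((1%:M - K *m H) *m x) <= L * enorm x.
  apply: seminorm_le_enorm => [x|a x|x y]; first exact: nrm0.
    by rewrite -scalemxAr nrmZ.
  by rewrite mulmxDr nrmD.
have [LK LK0 leLK] : exists2 L : R, 0 <= L &
    forall y, nrm (K *m y) <= L * enorm y.
  apply: seminorm_le_enorm => [x|a x|x y]; first exact: nrm0.
    by rewrite -scalemxAr nrmZ.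
  by rewrite mulmxDr nrmD.
have [M psiM] := psi_bounded.
pose D := LA * M + LA * M.
have leD x y : nrm ((1%:M - K *m H) *m (psi x - psi y)) <= D.
  rewrite mulmxBr; apply: le_trans (nrmD _ _) _.
  rewrite (_ : nrm (- _) = nrm ((1%:M - K *m H) *m psi y)); last first.
    by rewrite -[in LHS]scaleN1r nrmZ normrN1 mul1r.
  by apply: lerD; apply: le_trans (leLA _) _; exact: ler_wpM2l.
(* [kappa] is the constant in the bound of Gaussian second moments, and
   [g1 * gamma ^+ 2] bounds the mean of the noise term. *)
pose kappa : R := 4 * Num.sqrt 2.
pose g1 := 3 * ((r * LA) ^+ 2 * (kappa * \tr Sigmas)
  + LK ^+ 2 * (kappa * \tr Gammas)
  + LI ^+ 2 * (N%:R * (kappa * \tr (post_cov H (r ^+ 2 *: Sigma0) Gamma0)))).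
exists (g1 / (1 - alpha) ^+ 2) => sigma gamma sigma0 gamma0 rE Sigma Gamma.
move=> d Omega P xi eta init zeta s [[xiG etaG _] [zetaG sU _]].
pose udag w := truth psi r gamma u0 (fun k => xi k w).
pose ydag w := data H psi r gamma u0 (fun k => xi k w) (fun k => eta k w).
pose u w := opf H psi Sigma Gamma (fun n => init n w) (ydag w)
  (fun k n => zeta k n w) (fun k n => s k n w).
change (limn_esup (fun k => 'E_P[fun w => max_sqr_error nrm (u w k) (udag w k)])
  <= (g1 / (1 - alpha) ^+ 2 * gamma ^+ 2)%:E)%E.
have r_gt0 : 0 < r by rewrite rE divr_gt0.
have pdS : posdef (r ^+ 2 *: Sigma0) by apply: posdefZ => //; rewrite exprn_gt0.
have g20 : 0 < gamma ^+ 2 by rewrite exprn_gt0.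
have SigmaE : Sigma = gamma ^+ 2 *: (r ^+ 2 *: Sigma0).
  by rewrite scalerA -exprMn rE mulrC divfK// gt_eqF.
have KE : gain H Sigma Gamma = K by rewrite SigmaE gainZ.
have CE : post_cov H Sigma Gamma =
    gamma ^+ 2 *: post_cov H (r ^+ 2 *: Sigma0) Gamma0.
  by rewrite SigmaE post_covZ.
rewrite CE in zetaG; rewrite -KE in contr leLA leLK leD.
have pdC := posdef_possemidef (posdef_post_cov H pdS Gamma0_posdef).
pose G k w := noise_bound LA LK LI (r * gamma) gamma (xi k w) (eta k.+1 w)
  ((zeta k)^~ w).
have GP k : measurable_fun setT (G k) /\
    (\int[P]_w (G k w)%:E <= (g1 * gamma ^+ 2)%:E)%E.
  have momx := gaussian0_enorm_sqr Sigmas_possemidef (xiG k).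
  have momy := gaussian0_enorm_sqr Gammas_possemidef (etaG k).
  have momz m := gaussian0_enorm_sqr (possemidefZ (ltW g20) pdC) (zetaG k m).
  have [mG hG] := integral_noise_bound_le LA LK LI (r * gamma) gamma
    momx momy momz.
  split; first exact: mG.
  apply: le_trans hG _; rewrite lee_fin le_eqVlt; apply/orP; left; apply/eqP.
  by rewrite mxtraceZ /g1 /kappa; ring.
have G_ge0 k w : 0 <= G k w by exact: noise_bound_ge0.
(* The error at time [k + 1] is dominated by [majorant alpha D G k]. *)
apply: (@limn_esup_geometric_le _ _ alpha
  (2 * D ^+ 2 + 2 * (g1 * gamma ^+ 2))) => // k.
rewrite (mulrAC g1); apply: le_trans (integral_majorant_le D alpha_itv G_ge0
  (fun k => (GP k).1) (fun k => (GP k).2) k).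
rewrite unlock; apply: ae_le_integral_dom => [|w|w|].
- apply/measurable_EFinP; apply: measurable_majorant => j; exact: (GP j).1.
- by rewrite lee_fin; exact: bigmax_ge_id.
- by rewrite lee_fin; exact: majorant_ge0.
have s01 : {ae P, forall w, forall j n, 0 <= s j.+1 n w < 1}.
  apply/ae_foralln => j; apply: filter_forall => n; exact: uniform_ae01 (sU j n).
near=> w; have s01w : forall j n, 0 <= s j.+1 n w < 1 by near: w.
rewrite lee_fin.
have rg0 : 0 <= r * gamma by rewrite mulr_ge0// ltW.
elim: k => [|k ih].
  exact: (max_sqr_error_bounded nrm_norm LA0 LK0 LI0 leLA leLK leLI rg0
    (ltW gamma0) (u w 0%N) ((zeta 0%N)^~ w) (eta 1%N w) (s01w 0%N)
    leD (erefl (udag w 1%N))).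
have := max_sqr_error_contract nrm_norm LA0 LK0 LI0 leLA leLK leLI rg0
  (ltW gamma0) (u w k.+1) ((zeta k.+1)^~ w) (eta k.+2 w) (s01w k.+1) alpha_itv
  contr (erefl (udag w k.+2)).
move=> /le_trans; apply; rewrite lerD2r ler_wpM2l//.
by case/andP: alpha_itv.
Unshelve. all: by end_near. Qed.
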